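(* Consider the problem of learning a distribution in $\ell_p$ distance. (i) For every $2\le p\le\infty$ and $\delta\in(0,1)$ there is $c>0$ such that for all $n\ge2$ and $0<\epsilon<1$, every learner for support size $n$ with tolerance $\epsilon$ and failure probability $\delta$ draws at least $c/\epsilon^2$ samples. (ii) For every $1<p\le2$ (with $q=p/(p-1)$) and $\delta\in(0,1)$ there is $c>0$ such that for all $0<\epsilon<1$ and $n\ge1/\epsilon^q$, every such learner draws at least $c/\epsilon^q$ samples. (iii) For $1\le p\le2$ with Hölder conjugate $q$, there are no $\gamma>0$ and function $C:(0,1)\to(0,\infty)$ such that for every $\delta\in(0,1)$, every $0<\epsilon<1$ and every $n\ge2$ with $n\le1/\epsilon^q$, there is a learner for support size $n$ with tolerance $\epsilon$ and failure probability $\delta$ drawing at most $C(\delta)\,\dfrac{n}{(n^{1/q}\epsilon)^{2-\gamma}}$ samples.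
   Context: A distribution on support size $n$ is a vector $A\in\mathbb{R}^n$ with $A_i\ge0$, $\sum_iA_i=1$; $\|V\|_p=(\sum_i|V_i|^p)^{1/p}$, $\|V\|_\infty=\max_i|V_i|$. Learning: given $p,n,\epsilon,\delta$ and i.i.d. samples from an unknown distribution $A$ on $\{1,\dots,n\}$, the algorithm draws $m$ samples and must output a distribution $\hat A$ with $\|A-\hat A\|_p\le\epsilon$ with probability at least $1-\delta$, for every $A$. Hölder conjugate: $q=p/(p-1)$ for $1<p<\infty$, $q=\infty$ for $p=1$; when $q=\infty$, $n^{1/q}=1$ and $n\le1/\epsilon^q$ holds for every $n$.
   Formalization: In (i) and (ii) the learner is assumed to draw at least one sample; with zero samples the claims fail, e.g. n=2 and ε close to 1 (in (ii), ε=2^(-1/q)), where always outputting (1/2,1/2) is within tolerance ε. *)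

(* Defs.v *)
From HB Require Import structures.
From mathcomp Require Import all_boot all_order all_algebra.
From mathcomp Require Import all_classical all_reals all_analysis.

Set Implicit Arguments.
Unset Strict Implicit.
Unset Printing Implicit Defensive.
Import Order.TTheory GRing.Theory Num.Theory.
Import numFieldNormedType.Exports.

Local Open Scope classical_set_scope.
Local Open Scope ring_scope.

Definition is_distr (R : realType) (n : nat) (A : 'rV[R]_n) : Prop :=
  (forall i, 0 <= A ord0 i) /\ \sum_(i < n) A ord0 i = 1.

(* Only meant for 1 <= p <= +oo; the value at -oo is junk. *)
Definition lp_norm (R : realType) (p : \bar R) (n : nat) (V : 'rV[R]_n) : R :=
  match p with
  | r%:E => (\sum_(i < n) `|V ord0 i| `^ r) `^ r^-1
  | +oo%E => \big[Num.max/0]_(i < n) `|V ord0 i|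
  | -oo%E => 0
  end.

(* A possibly randomized estimator from m samples in {0, ..., n-1}. The internal
   randomness is a seed, drawn from an arbitrary probability space independently
   of the samples; a deterministic estimator is one that ignores its seed. The
   record allows m = 0: lower bounds on m that hold for every tolerance in (0,1)
   need 0 < m as a hypothesis, since for tolerances close to 1 and n = 2 always
   answering (1/2, 1/2) is a correct estimator using no sample. *)
Record learner (R : realType) (n m : nat) := Learner {
  seed_display : measure_display;
  seed : measurableType seed_display;
  seed_prob : probability seed R;
  estimate : m.-tuple 'I_n -> seed -> 'rV[R]_n;
  estimate_distr : forall s w, is_distr (estimate s w);
  measurable_estimate : forall s i,
    measurable_fun setT (fun w => estimate s w ord0 i)
}.
Arguments seed_prob {R n m} l.
Arguments estimate {R n m} l s w.

Definition iid_prob (R : realType) (n m : nat) (A : 'rV[R]_n)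
    (s : m.-tuple 'I_n) : R :=
  \prod_(j < m) A ord0 (tnth s j).

(* Measure of the event ||A - estimate||_p <= eps under the product of the law
   of m i.i.d. samples from A and the law of the seed. *)
Definition success_prob (R : realType) (n m : nat) (L : learner R n m)
    (p : \bar R) (eps : R) (A : 'rV[R]_n) : \bar R :=
  (\sum_(s : m.-tuple 'I_n)
     (iid_prob A s)%:E *
     seed_prob L [set w | (lp_norm p (A - estimate L s w) <= eps)%R])%E.

Definition learns (R : realType) (n m : nat) (L : learner R n m)
    (p : \bar R) (eps delta : R) : Prop :=
  forall A : 'rV[R]_n, is_distr A ->
    ((1 - delta)%:E <= success_prob L p eps A)%E.

(* 1 / eps^q for 0 < eps < 1, as an extended real: +oo when q = +oo. *)
Definition inv_pow (R : realType) (eps : R) (q : \bar R) : \bar R :=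
  match q with
  | r%:E => ((eps `^ r)^-1)%:E
  | _ => +oo%E
  end.

(* Main.v *)
Require Import Defs.
From HB Require Import structures.
From mathcomp Require Import all_boot all_order all_algebra.
From mathcomp Require Import all_classical all_reals all_analysis.
From mathcomp Require Import measurable_realfun ring lra.

Import Order.TTheory GRing.Theory Num.Theory.
Import numFieldNormedType.Exports.

Local Open Scope classical_set_scope.
Local Open Scope ring_scope.

(** Many hypotheses [A_k] are compared with one base distribution [A_0] through
    the chi-square affinity [sum_i A_k(i)^2 / A_0(i)], which tensorizes over the
    samples. If it is at most [B], and no tolerance ball contains more than [M]
    of the hypotheses, then averaging the success probabilities under [A_0] shows
    that [N] hypotheses force [N * (1 - delta)^2 <= M * B^m]; taking many of them
    is what covers failure probabilities close to 1. The rate [1/eps^2] comes from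
    constantly many two-point distributions, for which [B = 1 + O(eps^2)] and
    [M = 1]. The rate [1/eps^q] comes from all the subsets of a set of [k] points,
    [k] of order [1/eps^q], for which [B = 2] and [M <= 2^(k/2)]. *)

(** * Sums over samples, norms and measurability of success *)

Lemma sum_tuple_prod (R : comPzRingType) (n m : nat) (F : 'I_n -> R) :
  \sum_(s : m.-tuple 'I_n) \prod_(j < m) F (tnth s j) = (\sum_i F i) ^+ m.
Proof.
transitivity (\prod_(j < m) \sum_i F i); last by rewrite prodr_const card_ord.
rewrite bigA_distr_bigA /= (reindex (@finfun_of_tuple _ m)) /=; last first.
  by exists (@tuple_of_finfun _ m) => s _;
    rewrite (finfun_of_tupleK, tuple_of_finfunK).
by apply: eq_bigr => s _; apply: eq_bigr => j _; rewrite ffunE.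
Qed.

Lemma coord_le_lp_norm (R : realType) (p : \bar R) (n : nat) (V : 'rV[R]_n) i :
  (0 < p)%E -> `|V ord0 i| <= lp_norm p V.
Proof.
case: p => [r| |] //= p0; last exact: (le_bigmax _ (fun i => `|V ord0 i|)).
move: p0; rewrite lte_fin => r0.
have rK : r * r^-1 = 1 by rewrite divff // gt_eqF.
rewrite -[leLHS]powRr1 // -rK powRrM ge0_ler_powR ?invr_ge0 ?(ltW r0) //.
- by rewrite nnegrE powR_ge0.
- by rewrite nnegrE sumr_ge0 // => j _; rewrite powR_ge0.
by rewrite (bigD1 i) //= lerDl sumr_ge0 // => j _; rewrite powR_ge0.
Qed.

Lemma sum_powR_le (R : realType) (p eps : R) (n : nat) (V : 'rV[R]_n) :
  0 < p -> lp_norm p%:E V <= eps -> \sum_i `|V ord0 i| `^ p <= eps `^ p.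
Proof.
move=> p0 /= Veps.
have S0 : 0 <= \sum_i `|V ord0 i| `^ p.
  by apply: sumr_ge0 => i _; rewrite powR_ge0.
rewrite -[leLHS]powRr1 // -[X in _ `^ X](@mulVf _ p) ?gt_eqF // powRrM.
by rewrite ge0_ler_powR ?nnegrE ?powR_ge0 ?(ltW p0) // (le_trans _ Veps) ?powR_ge0.
Qed.

Lemma measurable_lp_norm (R : realType) (d : measure_display)
    (T : measurableType d) (p : \bar R) (n : nat) (f : T -> 'rV[R]_n) :
  (forall i, measurable_fun setT (fun w => f w ord0 i)) ->
  measurable_fun setT (fun w => lp_norm p (f w)).
Proof.
move=> mf.
have mnorm i : measurable_fun setT (fun w => `|f w ord0 i|).
  by apply: measurableT_comp.
case: p => [r| |] /=; last exact: measurable_cst.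
  apply: (measurableT_comp (measurable_powR r^-1)).
  apply: measurable_sum => i.
  exact: (measurableT_comp (measurable_powR r)).
elim: (index_enum _) => [|i s IH].
  rewrite [X in measurable_fun _ X](_ : _ = cst 0) //.
  by apply/funext => w; rewrite big_nil.
rewrite [X in measurable_fun _ X](_ : _ = (fun w => `|f w ord0 i|) \max
  (fun w => \big[Num.max/0]_(j <- s) `|f w ord0 j|)); first exact: measurable_maxr.
by apply/funext => w; rewrite big_cons.
Qed.

Lemma measurable_success (R : realType) (n m : nat) (L : learner R n m)
    (p : \bar R) (eps : R) (A : 'rV[R]_n) (s : m.-tuple 'I_n) :
  measurable [set w | lp_norm p (A - estimate L s w) <= eps].
Proof.
have mlp : measurable_fun setT (fun w => lp_norm p (A - estimate L s w)).
  apply: measurable_lp_norm => i.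
  rewrite [X in measurable_fun _ X](_ : _ = fun w => A ord0 i - estimate L s w ord0 i).
    by apply: measurable_funB => //; exact: measurable_estimate.
  by apply/funext => w; rewrite !mxE.
rewrite -[X in measurable X]setTI.
have := mlp measurableT _ (measurable_itv `]-oo, eps]).
by congr (measurable (_ `&` _)); apply/seteqP; split => w /=; rewrite in_itv.
Qed.

(** Integrate the pointwise bound. This handles randomized learners: each seed yields a single
    estimate, hence a single tolerance ball. *)
Lemma sum_probability_le (R : realType) (d : measure_display)
    (T : measurableType d) (P : probability T R) (I : finType)
    (E : I -> set T) (M : R) :
  (forall i, measurable (E i)) ->
  (forall w, (\sum_i \1_(E i) w <= M)%R) ->
  (\sum_i P (E i) <= M%:E)%E.
Proof.
move=> mE EM.
under eq_bigr => i _.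
  rewrite -[E i]setIT -(integral_indic P measurableT) //.
  over.
rewrite -ge0_integral_sum //; last first.
- by move=> i; apply/measurable_EFinP; exact: measurable_indic.
have -> : M%:E = (\int[P]_(x in setT) (cst M%:E x))%E.
  by rewrite integral_cst // [X in (_ * X)%E](_ : _ = 1%E) ?mule1 //; exact: probability_setT.
apply: ge0_le_integral => //.
- by move=> w _; apply: sume_ge0 => i _; rewrite lee_fin.
- apply: emeasurable_sum => i; apply/measurable_EFinP; exact: measurable_indic.
by move=> w _; rewrite /= sumEFin lee_fin; exact: EM.
Qed.

(** * The chi-square bound for many hypotheses *)

(* Weighted AM-GM: the likelihood ratio [a / b] is traded for its square under
   the base measure. *)
Lemma likelihood_le (R : realFieldType) (a b g t : R) :
  0 <= b -> (b = 0 -> a = 0) -> 0 <= g <= 1 -> 0 < t ->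
  a * g <= a ^+ 2 / b / (2 * t) + t / 2 * (b * g).
Proof.
rewrite le_eqVlt => /predU1P[<-|b0] a0 /andP[g0 g1] t0.
  by rewrite a0 // expr0n !(mul0r, mulr0) addr0.
rewrite -subr_ge0.
have -> : a ^+ 2 / b / (2 * t) + t / 2 * (b * g) - a * g =
   ((a - t * b * g) ^+ 2 + t ^+ 2 * b ^+ 2 * (g * (1 - g))) / (2 * t * b).
  by field; rewrite !gt_eqF.
apply: divr_ge0; last by rewrite !mulr_ge0 // ltW.
rewrite addr_ge0 ?sqr_ge0 // mulr_ge0 ?mulr_ge0 ?sqr_ge0 //; lra.
Qed.

(** One plus the chi-square divergence, for distributions with [A] vanishing wherever [A0] does.
    Division by zero yields [0], so that vanishing has to be assumed separately. *)
Definition chi2_affinity {R : realType} {n : nat} (A A0 : 'rV[R]_n) : R :=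
  \sum_i A ord0 i ^+ 2 / A0 ord0 i.

Lemma chi2_lower_bound (R : realType) (n m : nat) (L : learner R n m) (p : \bar R)
    (eps delta : R) (I : finType) (A : I -> 'rV[R]_n) (A0 : 'rV[R]_n) (B M : R) :
  learns L p eps delta -> delta < 1 ->
  is_distr A0 -> (forall k, is_distr (A k)) ->
  (forall k i, A0 ord0 i = 0 -> A k ord0 i = 0) ->
  0 < B -> (forall k, chi2_affinity (A k) A0 <= B) ->
  (forall C : 'rV[R]_n, #|[pred k | lp_norm p (A k - C) <= eps]|%:R <= M) ->
  #|I|%:R * (1 - delta) ^+ 2 <= M * B ^+ m.
Proof.
move=> Lok delta1 [A0pos A0sum] Ad A0A B0 AB AM.
pose E k s := [set w | lp_norm p (A k - estimate L s w) <= eps].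
pose g k s := fine (seed_prob L (E k s)).
have gE k s : (g k s)%:E = seed_prob L (E k s).
  by rewrite fineK // fin_num_measure //; exact: measurable_success.
have g01 k s : 0 <= g k s <= 1.
  rewrite -!lee_fin gE measure_ge0 /=.
  by apply: probability_le1; exact: measurable_success.
have gM s : \sum_k g k s <= M.
  rewrite -lee_fin -sumEFin; under eq_bigr do rewrite gE.
  apply: sum_probability_le => [k|w]; first exact: measurable_success.
  apply: le_trans (AM (estimate L s w)).
  rewrite -sum1_card natr_sum [leRHS]big_mkcond /=.
  apply: ler_sum => k _; rewrite indicE.
  by case: (boolP (w \in E k s)) => [/set_mem/= wE|_]; rewrite ?inE ?wE //; case: ifP.
have learnsE k : 1 - delta <= \sum_s iid_prob (A k) s * g k s.
  rewrite -lee_fin (le_trans (Lok _ (Ad k))) // /success_prob -sumEFin.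
  by apply: lee_sum => s _; rewrite EFinM gE.
have Q0 (s : m.-tuple 'I_n) : 0 <= iid_prob A0 s by apply: prodr_ge0.
have Qsum : \sum_(s : m.-tuple 'I_n) iid_prob A0 s = 1.
  by rewrite sum_tuple_prod A0sum expr1n.
(* Tensorization: the summand is a product of one-sample terms. *)
have chi k : \sum_(s : m.-tuple 'I_n) iid_prob (A k) s ^+ 2 / iid_prob A0 s <= B ^+ m.
  under eq_bigr => s _.
    rewrite -prodrXl -prodf_div. over.
  rewrite /= (sum_tuple_prod _ _ _ (fun i => A k ord0 i ^+ 2 / A0 ord0 i)).
  rewrite lerXn2r ?nnegrE ?(ltW B0) //; last exact: AB.
  by apply: sumr_ge0 => i _; rewrite divr_ge0 ?sqr_ge0.
have d0 : 0 < 1 - delta by rewrite subr_gt0.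
have Bm0 : 0 < B ^+ m by rewrite exprn_gt0.
(* With this [t] the chi-square term costs at most half of [1 - delta] per hypothesis; the other
   half is bounded through [M]. *)
set t := B ^+ m / (1 - delta).
have t0 : 0 < t by rewrite divr_gt0.
have : #|I|%:R * (1 - delta) <= #|I|%:R * (B ^+ m / (2 * t)) + t / 2 * M.
  apply: (@le_trans _ _ (\sum_k \sum_(s : m.-tuple 'I_n)
    (iid_prob (A k) s ^+ 2 / iid_prob A0 s / (2 * t)
      + t / 2 * (iid_prob A0 s * g k s)))).
    rewrite -sum1_card natr_sum mulr_suml; apply: ler_sum => k _.
    rewrite mul1r (le_trans (learnsE k)) //; apply: ler_sum => s _.
    apply: likelihood_le => //.
    rewrite /iid_prob => /eqP; rewrite prodf_seq_eq0 => /hasP[j _ /= /eqP Aj].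
    by rewrite (bigD1 j) //= A0A // mul0r.
  under eq_bigr do rewrite big_split /= -mulr_suml -mulr_sumr.
  rewrite big_split /=; apply: lerD.
    rewrite -sum1_card natr_sum mulr_suml; apply: ler_sum => k _.
    by rewrite mul1r ler_wpM2r // invr_ge0 mulr_ge0 // ltW.
  rewrite -mulr_sumr; apply: ler_wpM2l; first by rewrite divr_ge0 // ltW.
  (* The base law does not depend on [k], so [gM] applies once the sum over [k] is innermost. *)
  rewrite exchange_big /=.
  rewrite -[leRHS]mul1r -Qsum mulr_suml; apply: ler_sum => s _.
  by rewrite -mulr_sumr ler_wpM2l.
have -> : B ^+ m / (2 * t) = (1 - delta) / 2.
  by rewrite /t; field; rewrite !gt_eqF.
rewrite -(ler_pM2r (mulr_gt0 (ltr0Sn _ 1) d0)).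
have -> : (#|I|%:R * ((1 - delta) / 2) + t / 2 * M) * (2 * (1 - delta)) =
  #|I|%:R * (1 - delta) ^+ 2 + M * B ^+ m by rewrite /t; field; rewrite gt_eqF.
by lra.
Qed.

(** * Extending a small construction to any larger support *)

(** One extra point takes the missing mass and the rest is zero padding, so affinities do not depend
    on [n]. *)
Definition complete_distr {R : realType} {k : nat} (n : nat) (v : 'rV[R]_k) :
    'rV[R]_(k + n.+1) :=
  row_mx v (\row_j if j == ord0 then 1 - \sum_i v ord0 i else 0).

Lemma complete_distrEl (R : realType) (k n : nat) (v : 'rV[R]_k) i :
  complete_distr n v ord0 (lshift n.+1 i) = v ord0 i.
Proof. by rewrite row_mxEl. Qed.

Lemma complete_distrEr (R : realType) (k n : nat) (v : 'rV[R]_k) j :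
  complete_distr n v ord0 (rshift k j) =
  if j == ord0 then 1 - \sum_i v ord0 i else 0.
Proof. by rewrite row_mxEr mxE. Qed.

Lemma is_distr_complete (R : realType) (k n : nat) (v : 'rV[R]_k) :
  (forall i, 0 <= v ord0 i) -> \sum_i v ord0 i <= 1 ->
  is_distr (complete_distr n v).
Proof.
move=> v0 v1; split.
  move=> i; rewrite -(splitK i); case: (fintype.split i) => j /=.
    by rewrite complete_distrEl.
  by rewrite complete_distrEr; case: ifP => // _; rewrite subr_ge0.
rewrite big_split_ord /=; under eq_bigr do rewrite complete_distrEl.
rewrite [X in _ + X](bigD1 ord0) //= complete_distrEr eqxx [X in _ + (_ + X)]big1 ?addr0 ?subrKC //.
by move=> j /negbTE j0; rewrite complete_distrEr j0.
Qed.

Lemma chi2_affinity_complete (R : realType) (k n : nat) (v v0 : 'rV[R]_k) :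
  chi2_affinity (complete_distr n v) (complete_distr n v0) =
  chi2_affinity v v0 + (1 - \sum_i v ord0 i) ^+ 2 / (1 - \sum_i v0 ord0 i).
Proof.
rewrite {1}/chi2_affinity big_split_ord /=.
under eq_bigr do rewrite !complete_distrEl.
rewrite [X in _ + X](bigD1 ord0) //= !complete_distrEr eqxx
  [X in _ + (_ + X)]big1 ?addr0 //.
by move=> j /negbTE j0; rewrite !complete_distrEr j0 expr0n mul0r.
Qed.

Lemma complete_distr_eq0 (R : realType) (k n : nat) (v v0 : 'rV[R]_k) i :
  (forall i, 0 < v0 ord0 i) -> \sum_i v0 ord0 i < 1 ->
  complete_distr n v0 ord0 i = 0 -> complete_distr n v ord0 i = 0.
Proof.
move=> v00 v01; rewrite -(splitK i); case: (fintype.split i) => j /=.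
  by rewrite !complete_distrEl => v0j; have := v00 j; rewrite v0j ltxx.
rewrite !complete_distrEr; case: ifP => // _ /eqP.
by rewrite gt_eqF // subr_gt0.
Qed.

(** * The rate [1/eps^2] *)

(* Constantly many distributions on two points, [3 eps] apart: no tolerance
   ball meets two of them. *)
Lemma inverse_square_bound (R : realType) (p : \bar R) (delta : R) :
  (0 < p)%E -> delta < 1 ->
  exists2 K : nat, (0 < K)%N &
    forall (n : nat) (eps : R), (2 <= n)%N -> 0 < eps -> 6 * K%:R * eps <= 1 ->
    forall (m : nat) (L : learner R n m), learns L p eps delta ->
      1 <= 36 * K%:R ^+ 2 * eps ^+ 2 * m%:R.
Proof.
move=> p0 d1.
have d0 : 0 < (1 - delta) ^+ 2 by rewrite exprn_gt0 // subr_gt0.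
(* If the claimed bound failed, [B^m] would be at most [expR 1], too small for [K] separated
   hypotheses. *)
pose K := Num.bound (expR 1 / (1 - delta) ^+ 2).
have Kbig : expR 1 < K%:R * (1 - delta) ^+ 2.
  by rewrite -ltr_pdivrMr // archi_boundP // divr_ge0 ?expR_ge0 // ltW.
have K0 : (0 < K)%N.
  by rewrite lt0n; apply/eqP => K0; have := expR_gt0 (1 : R); rewrite K0 in Kbig; lra.
exists K => // n eps + e0 Ke m L Lok.
case: n L Lok => [|[|n]] // L Lok _.
rewrite leNgt; apply/negP => small.
pose v (h : R) : 'rV[R]_1 := const_mx (2^-1 + h).
pose A (j : 'I_K) := complete_distr n (v (3 * eps * j%:R)).
have sumv h : \sum_i v h ord0 i = 2^-1 + h by rewrite big_ord1 mxE.
have jK (j : 'I_K) : 0 <= 3 * eps * j%:R <= 3 * eps * K%:R.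
  by rewrite ler_wpM2l ?ler_nat ?(ltnW (ltn_ord j)) ?mulr_ge0 // ltW // mulr_gt0.
have dv h : 0 <= h <= 2^-1 -> is_distr (complete_distr n (v h)).
  by move=> h0; apply: is_distr_complete => [i|]; rewrite ?sumv ?mxE; lra.
have c0 : 0 <= 36 * K%:R ^+ 2 * eps ^+ 2 by rewrite mulr_ge0 ?sqr_ge0 // mulr_ge0 ?sqr_ge0.
have : #|'I_K|%:R * (1 - delta) ^+ 2 <=
    1 * (1 + 36 * K%:R ^+ 2 * eps ^+ 2) ^+ m.
  apply: (chi2_lower_bound _ (1 + n.+1) _ L p eps delta _ A (complete_distr n (v 0)) _ _ Lok d1).
  - by apply: dv; lra.
  - by move=> j; apply: dv; have := jK j; lra.
  - move=> j i; apply: complete_distr_eq0; rewrite ?sumv ?mxE; last by lra.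
    by move=> ?; rewrite mxE; lra.
  - lra.
  - move=> j; rewrite /A chi2_affinity_complete !sumv /chi2_affinity big_ord1 !mxE.
    (* Here [h <= 3 * K * eps], so [4 * h^2] is at most [36 * K^2 * eps^2]. *)
    move: (3 * eps * j%:R : R) (jK j) => h hK.
    have -> : (2^-1 + h) ^+ 2 / (2^-1 + 0) + (1 - (2^-1 + h)) ^+ 2 / (1 - (2^-1 + 0)) =
      1 + 4 * h ^+ 2 by field.
    have : h ^+ 2 <= (3 * eps * K%:R) ^+ 2 by nra.
    by rewrite !exprMn; lra.
  - move=> C; rewrite (ler_nat _ _ 1); apply/card_le1_eqP => i j.
    rewrite !inE => iC jC; apply/val_inj => /=.
    have near (l : 'I_K) : lp_norm p (A l - C) <= eps ->
        `|2^-1 + 3 * eps * l%:R - C ord0 (lshift n.+1 ord0)| <= eps.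
      move=> lC; apply: le_trans lC; apply: le_trans (coord_le_lp_norm _ _ _ _ (lshift n.+1 ord0) p0).
      by rewrite mxE [(- C) _ _]mxE /A complete_distrEl mxE.
    move: (near i iC) (near j jC); rewrite !ler_norml => /andP[i1 i2] /andP[j1 j2].
    (* Two hypotheses in one ball satisfy [3 * eps * |i - j| <= 2 * eps], impossible for distinct
       indices. *)
    clear p0 near; case: (ltngtP i j) => //; rewrite -(ler_nat R) -natr1 -subr_ge0;
    by move=> /(mulr_ge0 (ltW e0)) ij; exfalso; lra.
rewrite card_ord mul1r leNgt => /negP; apply.
apply: le_lt_trans Kbig.
apply: (@le_trans _ _ (expR (36 * K%:R ^+ 2 * eps ^+ 2) ^+ m)).
  rewrite lerXn2r ?nnegrE ?expR_ge0 ?expR_ge1Dx //.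
  lra.
by rewrite -expRM_natr ler_expR ltW.
Qed.

(** * The rate [1/eps^q] *)

(* Markov's inequality for [4^-d], where [d] is the Hamming distance to [z0];
   [256] is just above [4 * (5 / 4)^16]. *)
Lemma card_hamming_ball (R : realFieldType) (r : nat) (z0 : {set 'I_(16 * r)}) :
  #|[pred z : {set 'I_(16 * r)} |
      (#|[pred i | (i \in z) != (i \in z0)]| <= r)%N]|%:R <= (256 ^+ r : R).
Proof.
pose w (z : {set 'I_(16 * r)}) : R :=
  \prod_i if (i \in z) != (i \in z0) then 4^-1 else 1.
have wE z : w z = 4^-1 ^+ #|[pred i | (i \in z) != (i \in z0)]|.
  by rewrite /w -big_mkcond /= prodr_const.
have wsum : \sum_z w z = (5 / 4) ^+ (16 * r).
  transitivity (\prod_(i < 16 * r)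
      ((if i \notin z0 then 4^-1 else 1) + (if i \in z0 then 4^-1 else 1) : R)).
    rewrite bigA_distr; apply: eq_bigr => z _; apply: eq_bigr => i _.
    by case: (i \in z); case: (i \in z0).
  transitivity (\prod_(i < 16 * r) (5 / 4 : R)).
    by apply: eq_bigr => i _; case: (i \in z0) => /=; field.
  by rewrite prodr_const card_ord.
have ball : #|[pred z : {set 'I_(16 * r)} |
    (#|[pred i | (i \in z) != (i \in z0)]| <= r)%N]|%:R * 4^-1 ^+ r <= \sum_z w z.
  rewrite -sum1_card natr_sum mulr_suml [leLHS]big_mkcond /=; apply: ler_sum => z _.
  rewrite wE mul1r; case: ifP => zr; last by rewrite exprn_ge0.
  by rewrite ler_wiXn2l // invf_le1 ?ler1n.
have q0 : 0 < (4^-1 : R) ^+ r by rewrite exprn_gt0 // invr_gt0.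
rewrite -(ler_pM2r q0) (le_trans ball) // wsum exprM -exprMn.
by rewrite lerXn2r ?nnegrE //; lra.
Qed.

(* The hypotheses give weight [1/k] to each point of a subset of a [k]-set, with
   [k = 16 * r], and the remaining mass to one further point. Rounding an estimate
   to the nearest subset errs on at most [r] points, so a tolerance ball contains
   at most [256^r] of the [2^k] hypotheses, while their chi-square affinity to the
   mean is at most [2]. *)
Lemma subset_family_bound (R : realType) (p eps delta : R) (r n m : nat)
    (L : learner R (16 * r + n.+1) m) :
  0 < p -> (0 < r)%N -> delta < 1 -> (32 * r%:R * eps) `^ p <= r%:R -> 0 <= eps ->
  learns L p%:E eps delta -> 2 ^+ (8 * r) * (1 - delta) ^+ 2 <= 2 ^+ m.
Proof.
move=> p0 r0 d1 epsr e0 Lok.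
set k := (16 * r)%N in L Lok *.
have k0 : 0 < k%:R :> R by rewrite ltr0n muln_gt0.
have kV0 : 0 < k%:R^-1 :> R by rewrite invr_gt0.
pose v (z : {set 'I_k}) : 'rV[R]_k := \row_i ((i \in z)%:R / k%:R).
pose v0 : 'rV[R]_k := const_mx (k%:R^-1 / 2).
have sumv z : 0 <= \sum_i v z ord0 i <= 1.
  rewrite sumr_ge0 => [|i _] /=; last by rewrite mxE divr_ge0 ?ler0n.
  rewrite -[leRHS](@mulfV _ k%:R) ?gt_eqF //.
  under eq_bigr do rewrite mxE.
  rewrite -mulr_suml ler_wpM2r ?(ltW kV0) // -natr_sum ler_nat.
  rewrite -[leqRHS]card_ord -sum1_card; apply: leq_sum => i _; exact: leq_b1.
have sumv0 : \sum_i v0 ord0 i = 2^-1.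
  under eq_bigr do rewrite mxE.
  by rewrite sumr_const card_ord -mulr_natr; field; rewrite gt_eqF.
have v00 i : 0 < v0 ord0 i by rewrite mxE divr_gt0.
have : #|{set 'I_k}|%:R * (1 - delta) ^+ 2 <= 256 ^+ r * 2 ^+ m.
  apply: (chi2_lower_bound _ _ _ L p%:E eps delta _ (fun z => complete_distr n (v z))
    (complete_distr n v0) _ _ Lok d1).
  - by apply: is_distr_complete => [i|]; rewrite ?(ltW (v00 i)) // sumv0; lra.
  - move=> z; apply: is_distr_complete => [i|]; last by have /andP[] := sumv z.
    by rewrite mxE divr_ge0 ?ler0n.
  - by move=> z i; apply: complete_distr_eq0 => //; rewrite sumv0; lra.
  - lra.
  - move=> z; rewrite chi2_affinity_complete sumv0.
    have -> : chi2_affinity (v z) v0 = 2 * \sum_i v z ord0 i.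
      rewrite mulr_sumr; apply: eq_bigr => i _; rewrite !mxE.
      by case: (i \in z) => /=; field; rewrite gt_eqF.
    have -> : 1 - 2^-1 = 2^-1 :> R by field.
    (* With mass [u] on the subset the affinity is [2u + 2(1-u)^2 = 2 - 2u(1-u)]. *)
    by move: (\sum_i _) (sumv z) => u /andP[u0 u1]; rewrite invrK; nra.
  (* The threshold lies midway between [0] and [1/k], so each point where [z] and [z0] differ costs
     at least [1/(2k)]. *)
  - move=> C; pose z0 := [set i | k%:R^-1 / 2 <= C ord0 (lshift n.+1 i)]%SET.
    apply: le_trans (card_hamming_ball R r z0); rewrite ler_nat.
    apply/subset_leq_card/fintype.subsetP => z; rewrite !inE.
    set S := [pred i | _] => /(sum_powR_le _ _ _ _ _ p0) zC.
    rewrite -(ler_nat R) (le_trans _ epsr) //.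
    have far i : i \in S ->
        k%:R^-1 / 2 <= `|(complete_distr n (v z) - C) ord0 (lshift n.+1 i)|.
      rewrite inE [in leRHS]mxE [(- C) _ _]mxE complete_distrEl mxE inE.
      case: (i \in z); case: leP => //= Ci _; rewrite ?mul1r ?mul0r ?sub0r.
        by rewrite ger0_norm; lra.
      by rewrite normrN ger0_norm //; lra.
    have : #|S|%:R * (k%:R^-1 / 2) `^ p <= eps `^ p.
      apply: le_trans zC; rewrite big_split_ord /= -[leLHS]addr0.
      apply: lerD; last by apply: sumr_ge0 => i _; exact: powR_ge0.
      rewrite -sum1_card natr_sum mulr_suml [leLHS]big_mkcond /=; apply: ler_sum => i _.
      case: ifP => iS; last exact: powR_ge0.
      rewrite mul1r; apply: ge0_ler_powR; rewrite ?nnegrE ?(ltW p0) //.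
      exact: far.
    have kp : 0 < (k%:R^-1 / 2 : R) `^ p by rewrite powR_gt0 // divr_gt0.
    rewrite -ler_pdivlMr // => /le_trans; apply.
    rewrite ler_pdivrMr // -powRM ?mulr_ge0 ?ler0n ?divr_ge0 ?(ltW kV0) //.
    rewrite [X in _ <= X `^ _](_ : _ = eps) // /k natrM.
    by field; rewrite pnatr_eq0 -lt0n.
rewrite -cardsT -powersetT card_powerset cardsT card_ord natrX.
(* [2^k] is the square of [256^r]; one factor cancels the ball bound. *)
have -> : k = (8 * r + 8 * r)%N by rewrite -mulnDl.
have -> : 256 ^+ r = 2 ^+ (8 * r) :> R by rewrite exprM; congr (_ ^+ _); ring.
by rewrite exprD -mulrA ler_pM2l // exprn_gt0.
Qed.

(** The condition [(32 r eps)^p <= r] of the subset family means [r <= (32 eps)^(-p/(p-1))], which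
    is where the conjugate exponent arises; [r] is taken as the integer part of that bound. *)
Lemma inverse_power_bound (R : realType) (p q delta : R) :
  1 < p -> q = p / (p - 1) -> delta < 1 ->
  exists2 c : R, 0 < c &
    forall (n : nat) (eps : R), 0 < eps -> 1 / eps `^ q <= n%:R ->
    forall (m : nat) (L : learner R n m), (0 < m)%N ->
      learns L p%:E eps delta -> c / eps `^ q <= m%:R.
Proof.
move=> p1 qE d1.
have p0 : 0 < p by lra.
have q1 : 1 <= q by rewrite qE ler_pdivlMr; lra.
have d0 : 0 < (1 - delta) ^+ 2 by rewrite exprn_gt0 // subr_gt0.
(* For [r >= r0] a factor [2^r] outweighs [(1 - delta)^2]. *)
pose r0 := Num.bound ((1 - delta) ^- 2).
have r0big : (1 - delta) ^- 2 < r0%:R by rewrite archi_boundP // invr_ge0 ltW.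
have r00 : (0 < r0)%N.
  by rewrite -(ltr_nat R) (lt_trans _ r0big) // invr_gt0.
exists ((32 `^ q)^-1 / (r0%:R + 1)).
  by rewrite !divr_gt0 ?invr_gt0 ?powR_gt0 // ltr_wpDl.
move=> n eps e0 neps m L m0 Lok.
have eq0 : 0 < eps `^ q by exact: powR_gt0.
have sq0 : 0 < 32 `^ q :> R by exact: powR_gt0.
pose X := ((32 * eps) `^ q)^-1.
have XE : X = (32 `^ q)^-1 / eps `^ q by rewrite /X powRM ?invfM // ltW.
have X0 : 0 < X by rewrite invr_gt0 powR_gt0 // mulr_gt0.
have -> : (32 `^ q)^-1 / (r0%:R + 1) / eps `^ q = X / (r0%:R + 1).
  by rewrite XE mulrAC.
have m1 : 1 <= m%:R :> R by rewrite ler1n.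
rewrite ler_pdivrMr ?ltr_wpDl //.
pose r := Num.truncn X.
have /andP[rX Xr] : r%:R <= X < r.+1%:R by rewrite truncn_itv // ltW.
rewrite -natr1 in Xr.
(* For [r < r0] the claimed bound is at most [1], so [0 < m] suffices. *)
have [rsmall|rbig] := ltnP r r0.
  move: rsmall; rewrite -(ler_nat R) -natr1 => rsmall.
  have : r0%:R + 1 <= m%:R * (r0%:R + 1) :> R by rewrite ler_peMl //; lra.
  lra.
have r_gt0 : (0 < r)%N by exact: leq_trans r00 rbig.
have r1 : 1 <= r%:R :> R by rewrite ler1n.
(* Since [q >= 1], [32 <= 32^q], hence [32 X <= 1/eps^q <= n]. *)
have nr : (16 * r < n)%N.
  rewrite -(ltr_nat R) natrM.
  have : 32 * X <= n%:R.
    apply: le_trans neps; rewrite XE div1r mulrA ler_piMl ?invr_ge0 ?(ltW eq0) //.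
    by rewrite ler_pdivrMr // mul1r le1r_powR // ler1n.
  lra.
have rp : (32 * r%:R * eps) `^ p <= r%:R.
  have w0 : 0 < 32 * eps by rewrite mulr_gt0.
  have -> : 32 * r%:R * eps = r%:R * (32 * eps) by ring.
  rewrite powRM ?(ltW w0) ?ler0n // -{1}(subrK 1 p) powRD ?pnatr_eq0 -?lt0n ?r_gt0 ?implybT //.
  rewrite powRr1 ?ler0n // mulrAC ler_piMl ?ler0n //.
  rewrite -ler_pdivlMr ?powR_gt0 // div1r.
  have -> : ((32 * eps) `^ p)^-1 = X `^ (p - 1).
    rewrite /X -!powRN -powRrM qE; congr (_ `^ _).
    by field; rewrite subr_eq0 gt_eqF.
  by rewrite ge0_ler_powR ?nnegrE ?subr_ge0 ?ler0n ?(ltW X0) // ltW.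
suff rm : (r <= m)%N.
  move: rm; rewrite -(ler_nat R) => rm.
  have : 1 <= r0%:R :> R by rewrite ler1n.
  by move=> /(ler_wpM2l (ler0n R m)); lra.
have [n' nE] : exists n', n = (16 * r + n'.+1)%N.
  by exists (n - (16 * r).+1)%N; rewrite addnS -addSn subnKC.
subst n.
have := subset_family_bound _ _ _ _ _ _ _ L p0 r_gt0 d1 rp (ltW e0) Lok.
have big : 1 <= 2 ^+ r * (1 - delta) ^+ 2.
  rewrite -ler_pdivrMr // div1r (le_trans (ltW r0big)) // -natrX ler_nat.
  by rewrite (leq_trans rbig) // ltnW // ltn_expl.
(* One of the eight factors [2^r] absorbs the confidence term, leaving [7 r <= m]. *)
rewrite mulSn exprD mulrAC => /(le_trans (ler_peMl _ big)).
rewrite exprn_ge0 // => /(_ isT).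
rewrite ler_eXn2l ?ltr1n // => rm.
by rewrite (leq_trans _ rm) // leq_pmull.
Qed.

(** * The regime [n <= 1/eps^q] and the three statements *)

(** As [q >= 1], support size [2] stays in the regime of the third statement for all small [eps]. *)
Lemma inv_pow_hoelder_conjugate_ge2 (R : realType) (p eps : R) :
  1 <= p -> 0 < eps <= 2^-1 -> (2%:E <= inv_pow eps (hoelder_conjugate p%:E))%E.
Proof.
rewrite le_eqVlt => /predU1P[<-|p1] /andP[e0 e1].
  by rewrite hoelder_conjugate1 leey.
have p0 : 0 < p by lra.
rewrite /hoelder_conjugate /= eqe gt_eqF // -EFinD inver subr_eq0 gt_eqF //=.
rewrite lee_fin -[leLHS]invrK lef_pV2 ?posrE ?powR_gt0 ?invr_gt0 //.
apply: (le_trans _ e1); rewrite -[leRHS]powRr1 ?(ltW e0) //.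
apply: ger_powR; first by rewrite e0; lra.
by rewrite ler_pdivlMr; lra.
Qed.

Theorem theorem10 (R : realType) :
  (forall (p : \bar R) (delta : R), (2%:E <= p)%E -> 0 < delta < 1 ->
     exists2 c : R, 0 < c &
       forall (n : nat) (eps : R), (2 <= n)%N -> 0 < eps < 1 ->
       forall (m : nat) (L : learner R n m), (0 < m)%N ->
         learns L p eps delta -> c / eps ^+ 2 <= m%:R)
  /\
  (forall p q delta : R, 1 < p <= 2 -> q = p / (p - 1) -> 0 < delta < 1 ->
     exists2 c : R, 0 < c &
       forall (n : nat) (eps : R), 0 < eps < 1 -> 1 / eps `^ q <= n%:R ->
       forall (m : nat) (L : learner R n m), (0 < m)%N ->
         learns L p%:E eps delta -> c / eps `^ q <= m%:R)
  /\
  (forall (p : R) (q : \bar R), 1 <= p <= 2 -> q = hoelder_conjugate p%:E ->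
     ~ exists (gamma : R) (C : R -> R),
       [/\ 0 < gamma,
           (forall delta : R, 0 < delta < 1 -> 0 < C delta) &
           forall (delta eps : R) (n : nat),
             0 < delta < 1 -> 0 < eps < 1 -> (2 <= n)%N ->
             ((n%:R)%:E <= inv_pow eps q)%E ->
             exists (m : nat) (L : learner R n m),
               learns L p%:E eps delta /\
               m%:R <= C delta *
                 (n%:R / (n%:R `^ fine (q^-1)%E * eps) `^ (2 - gamma))]).
Proof.
split; [|split].
- move=> p delta p2 /andP[_ d1].
  have [] := inverse_square_bound R p delta _ d1.
    by rewrite (lt_le_trans _ p2) // lte_fin.
  move=> K K0 bound; have K0' : 0 < K%:R :> R by rewrite ltr0n.
  exists (36 * K%:R ^+ 2)^-1; first by rewrite invr_gt0 mulr_gt0 // exprn_gt0.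
  move=> n eps n2 /andP[e0 _] m L m0 Lok.
  have Ke0 : 0 < 36 * K%:R ^+ 2 * eps ^+ 2.
    by rewrite !pmulr_lgt0 ?exprn_gt0.
  rewrite -invfM -div1r ler_pdivrMr // mulrC.
  (* For larger [eps] the two-point family does not fit, but then [m >= 1] already gives the
     bound. *)
  have [Ke|Ke] := leP (6 * K%:R * eps) 1; first exact: (bound n eps n2 e0 Ke m L Lok).
  have -> : 36 * K%:R ^+ 2 * eps ^+ 2 = (6 * K%:R * eps) ^+ 2 by ring.
  by rewrite mulr_ege1 ?ler1n // exprn_ege1 // ltW.
- move=> p q delta /andP[p1 _] qE /andP[_ d1].
  have [c c0 bound] := inverse_power_bound R p q delta p1 qE d1.
  by exists c => // n eps /andP[e0 _]; exact: bound.
(* Already false for [n = 2] and [eps] tending to 0. *)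
move=> p q /andP[p1 _] qE [gamma [C [g0 C0 ub]]].
have p0 : (0 < p%:E)%E by rewrite lte_fin; lra.
have [K K0 lb] := inverse_square_bound R p%:E 2^-1 p0 ltac:(lra).
have K1 : 1 <= K%:R :> R by rewrite ler1n.
set a : R := 2 `^ fine (q^-1)%E.
have a0 : 0 < a by exact: powR_gt0.
(* [D * eps^gamma] is what the lower-bound expression becomes at the assumed upper bound on [m]. *)
pose D := 36 * K%:R ^+ 2 * C 2^-1 * 2 / a `^ (2 - gamma).
have D0 : 0 < D.
  have C1 : 0 < C 2^-1 by apply: C0; lra.
  by rewrite /D !pmulr_lgt0 ?invr_gt0 ?powR_gt0 ?exprn_gt0 ?ltr0n.
(* The first term makes the two-point bound available; the second forces [D * eps^gamma <= 1/2],
   contradicting the lower bound [1]. *)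
pose eps := Num.min (6 * K%:R)^-1 ((2 * D)^-1 `^ gamma^-1).
have eK : eps <= (6 * K%:R)^-1 by rewrite ge_min lexx.
have eD : eps <= (2 * D)^-1 `^ gamma^-1 by rewrite ge_min lexx orbT.
have e0 : 0 < eps.
  by rewrite lt_min powR_gt0 ?invr_gt0 ?andbT pmulr_lgt0 // ltr0n.
have e6 : eps <= 6^-1.
  by rewrite (le_trans eK) // lef_pV2 ?posrE; lra.
have [||||m [L [Lok mle]]] := ub 2^-1 eps 2%N.
- lra.
- lra.
- by [].
- by rewrite qE inv_pow_hoelder_conjugate_ge2 // e0; lra.
have Ke : 6 * K%:R * eps <= 1.
  by rewrite mulrC -ler_pdivlMr ?mul1r //; lra.
have := lb 2%N eps isT e0 Ke m L Lok.
have : 36 * K%:R ^+ 2 * eps ^+ 2 * m%:R <= D * eps `^ gamma.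
  apply: le_trans (ler_wpM2l _ mle) _; first by rewrite mulr_ge0 ?sqr_ge0.
  have -> : eps ^+ 2 = eps `^ (2 - gamma) * eps `^ gamma.
    by rewrite -powRD ?subrK ?powR_mulrn ?(ltW e0) // gt_eqF ?implybT.
  rewrite -/a powRM ?(ltW a0) ?(ltW e0) // /D le_eqVlt; apply/orP; left.
  by apply/eqP; field; rewrite !gt_eqF ?powR_gt0.
have : eps `^ gamma <= (2 * D)^-1.
  apply: (@le_trans _ _ (((2 * D)^-1 `^ gamma^-1) `^ gamma)).
    by rewrite ge0_ler_powR ?nnegrE ?powR_ge0 ?(ltW g0) ?(ltW e0).
  by rewrite -powRrM mulVf ?gt_eqF // powRr1 // invr_ge0 mulr_ge0 // ltW.
have -> : (2 * D)^-1 = 2^-1 / D by rewrite invfM.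
by rewrite ler_pdivlMr // mulrC; lra.
Qed.
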